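(* Let $q$ be a prime power, $r\ge2$, $h=r-1$, let $H=(V,\mathcal E,\psi_H)$ be an $r$-uniform hypergraph, fix an integer $t\ge1$, and identify a set of $q^t$ colours with $\mathbb F_q^t$. Consider the map $(a_1,\ldots,a_t)\mapsto(\Phi_H(a_1),\ldots,\Phi_H(a_t))$ from $t$-tuples of vertex labellings $a_j:V\to\mathbb F_q$ to $\mathcal C_H^t$. (i) The labelling $\gamma(v):=(a_1(v),\ldots,a_t(v))$ is a weak colouring of $H$ if and only if the image $t$-tuple has full joint support (i.e. the union of the supports of $\Phi_H(a_1),\ldots,\Phi_H(a_t)$ is $\mathcal E$). (ii) Every $t$-tuple of codewords in $\mathcal C_H^t$ has exactly $q^{t\kappa(H)}$ preimages. Consequently, $\chi_H^{\mathrm w}(q^t)=q^{t\kappa(H)}p_{\mathcal C_H}(q^t)$.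
   Context: A finite hypergraph is a triple $H=(V,\mathcal E,\psi_H)$ with finite sets $V$, $\mathcal E$ and a map $\psi_H:\mathcal E\to2^V\setminus\{\emptyset\}$ (distinct edges may have the same vertex set; $e$ is identified with $\psi_H(e)$). It is $r$-uniform if $|e|=r$ for all edges. $\kappa(H)$ is the number of connected components of $H$ (classes of vertices joined by walks $u_0,e_1,u_1,\ldots,e_\ell,u_\ell$ with $u_{i-1},u_i\in e_i$), isolated vertices included. A weak colouring is a map on $V$ that is not constant on any edge; $\chi_H^{\mathrm w}(s)$ is the number of weak colourings $V\to\{1,\ldots,s\}$. Code $\mathcal C_H$: for each edge fix an ordering $e=(v_{e,1},\ldots,v_{e,r})$, and fix an $\mathbb F_q$-linear bijection $\iota:\mathbb F_q^h\to\mathbb F_{q^h}$. For $a:V\to\mathbb F_q$ let $\Phi_H(a):=\bigl(\iota\bigl((a(v_{e,j})-a(v_{e,1}))_{2\le j\le r}\bigr)\bigr)_{e\in\mathcal E}\in\mathbb F_{q^h}^{|\mathcal E|}$, and $\mathcal C_H:=\operatorname{Im}(\Phi_H)$, an $\mathbb F_q$-subspace with coordinates indexed by $\mathcal E$. The support of a codeword is its set of nonzero coordinates. For $A\subseteq\mathcal E$ let $\mathcal C_H(A)$ be the subspace of codewords of $\mathcal C_H$ vanishing on $A$. The characteristic polynomial is $p_{\mathcal C_H}(z):=\sum_{A\subseteq\mathcal E}(-1)^{|A|}z^{\dim_{\mathbb F_q}\mathcal C_H(A)}$. *)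

(* Defs.v *)
From HB Require Import structures.
From mathcomp Require Import all_boot all_order all_algebra all_field.

Set Implicit Arguments.
Unset Strict Implicit.
Unset Printing Implicit Defensive.

Import GRing.Theory.
Local Open Scope ring_scope.

Record hypergraph := Hypergraph {
  vertex : finType;
  edge : finType;
  ends : edge -> {set vertex};
  ends_neq0 : forall e, ends e != set0 }.

Definition uniform (r : nat) (H : hypergraph) : Prop :=
  forall e : edge H, #|ends e| = r.

Definition adjacent (H : hypergraph) : rel (vertex H) :=
  fun u w => [exists e : edge H, (u \in ends e) && (w \in ends e)].

Definition kappa (H : hypergraph) : nat := n_comp (@adjacent H) (vertex H).

(* [n_comp] counts classes of [connect] when the latter is symmetric. *)
Lemma adjacent_connect_sym (H : hypergraph) : connect_sym (@adjacent H).
Proof.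
apply: sym_connect_sym => u w.
by apply/existsP/existsP => -[e]; exists e; rewrite andbC.
Qed.

Definition weak_colouring (H : hypergraph) (C : eqType)
    (g : vertex H -> C) : bool :=
  [forall e : edge H,
     ~~ [forall u in ends e, forall w in ends e, g u == g w]].

Definition weak_chi (H : hypergraph) (s : nat) : nat :=
  #|[set g : {ffun vertex H -> 'I_s} | weak_colouring g]|.

Definition edge_ordering (H : hypergraph) (r : nat)
    (v : edge H -> r.-tuple (vertex H)) : Prop :=
  forall e : edge H, uniq (v e) /\ ends e =i v e.

Section Codes.
Variables (F : fieldType) (L : fieldExtType F) (E : finType).
Implicit Types (c : {ffun E -> L}) (A : {set E}) (C : {vspace {ffun E -> L}}).

Definition codeword_support c : {set E} := [set e | c e != 0].

Definition coordinate (e : E) c : L := c e.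

Lemma coordinate_is_linear e : linear (coordinate e).
Proof. by move=> k c d; rewrite /coordinate !ffunE. Qed.
HB.instance Definition _ e :=
  GRing.isLinear.Build F {ffun E -> L} L _ (coordinate e)
    (coordinate_is_linear e).

Definition vanishing C A : {vspace {ffun E -> L}} :=
  (C :&: \bigcap_(e in A) lker (linfun (coordinate e)))%VS.

Lemma vanishingP C A c :
  reflect (c \in C /\ forall e, e \in A -> c e = 0) (c \in vanishing C A).
Proof.
rewrite memv_cap; apply: (iffP andP) => -[-> cA]; split=> //.
  move=> e eA; move: cA; rewrite (bigD1 e) //= memv_cap => /andP[+ _].
  by rewrite memv_ker lfunE => /eqP.
rewrite memvE; apply/subv_bigcapP => e eA.
by rewrite -memvE memv_ker lfunE /= /coordinate cA.
Qed.

Definition char_poly_code C : {poly int} :=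
  \sum_(A : {set E}) (-1) ^+ #|A| *: 'X^(\dim (vanishing C A)).

End Codes.

Section HypergraphCode.
Variables (F : finFieldType) (L : fieldExtType F) (H : hypergraph) (h : nat).
Variables (v : edge H -> h.+1.-tuple (vertex H)).
Variables (iota : {linear 'rV[F]_h -> L}).

(* [F^o] is [F] as a vector space over itself. *)
Definition Phi (a : {ffun vertex H -> F^o}) : {ffun edge H -> L} :=
  [ffun e => iota (\row_(j < h)
     (a (tnth (v e) (lift ord0 j)) - a (tnth (v e) ord0)))].

Lemma Phi_is_linear : linear Phi.
Proof.
move=> k a b; apply/ffunP => e; rewrite !ffunE -linearP; congr (iota _).
by apply/rowP => j; rewrite !mxE !ffunE mulrBr opprD addrACA.
Qed.
HB.instance Definition _ :=
  GRing.isLinear.Build F {ffun vertex H -> F^o} {ffun edge H -> L} _ Phi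
    Phi_is_linear.

Definition code : {vspace {ffun edge H -> L}} := limg (linfun Phi).

Lemma codeP (c : {ffun edge H -> L}) :
  reflect (exists a, Phi a = c) (c \in code).
Proof.
apply: (iffP memv_imgP) => [[a _ ->]|[a <-]]; exists a; rewrite ?lfunE //.
exact: memvf.
Qed.

Definition Phi_tuple (t : nat) (a : t.-tuple {ffun vertex H -> F}) :
  t.-tuple {ffun edge H -> L} := [tuple Phi (tnth a j) | j < t].

End HypergraphCode.

(* Main.v *)
(* A coordinate of Phi_H(a) vanishes exactly when a is constant on that edge.
   Hence ker Phi_H consists of the labellings constant on connected components
   and has q^kappa(H) elements, and a tuple of labellings is constant on all edges
   of A exactly when its images all lie in C_H(A); inclusion-exclusion over the
   set of monochromatic edges then yields the chromatic identity. *)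
Require Import Defs.
From mathcomp Require Import all_boot all_order all_algebra all_field.

Set Implicit Arguments.
Unset Strict Implicit.
Unset Printing Implicit Defensive.

Import GRing.Theory.
Local Open Scope ring_scope.

(** * Preliminary counting: signed sums over subsets, tuples and changes of colour set *)

Lemma sum_sign_subset (R : comNzRingType) (E : finType) (Z : {set E}) :
  \sum_(A : {set E} | A \subset Z) (-1) ^+ #|A| = (Z == set0)%:R :> R.
Proof.
(* The factor [G e + 1] is 0 on [Z] and 1 off it, so the product tests whether [Z] is empty.
   Distributing it gives one term per subset [A], which vanishes as soon as [A] leaves [Z]. *)
pose G (e : E) : R := if e \in Z then -1 else 0.
transitivity (\prod_(e : E) (G e + 1)); last first.
  have [Z0|[e eZ]] := set_0Vmem Z.
    by rewrite Z0 eqxx big1 // => e _; rewrite /G Z0 inE add0r.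
  rewrite (bigD1 e) //= /G eZ addNr mul0r.
  by case: eqP => // Z0; rewrite Z0 inE in eZ.
rewrite bigA_distr big_mkcond /=; apply: eq_bigr => A _.
case: ifPn => [/subsetP AZ|/subsetPn[e eA eZ]]; last first.
  by rewrite (bigD1 e) //= eA /G (negPf eZ) mul0r.
rewrite -big_mkcond /= -prodr_const; apply: eq_bigr => e eA.
by rewrite /G AZ.
Qed.

Lemma card_tuple_family (T : finType) (t : nat) (P : 'I_t -> pred T) :
  #|[set a : t.-tuple T | [forall j, P j (tnth a j)]]| = (\prod_(j < t) #|P j|)%N.
Proof.
have <- : #|family P| = (\prod_(j < t) #|P j|)%N.
  by rewrite card_family foldrE big_map big_enum.
pose f (a : t.-tuple T) : {ffun 'I_t -> T} := [ffun j => tnth a j].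
have f_inj : injective f.
  by move=> a b /ffunP ab; apply: eq_from_tnth => j; have := ab j; rewrite !ffunE.
rewrite -(card_imset _ f_inj); apply: eq_card => g.
apply/imsetP/familyP => [[a + ->] j|gP].
  by rewrite inE ffunE => /forallP/(_ j).
exists [tuple g j | j < t]; last by apply/ffunP => j; rewrite ffunE tnth_mktuple.
by rewrite inE; apply/forallP => j; rewrite tnth_mktuple; apply: gP.
Qed.

(** Allows colours to be renamed, so that numbers below $q^t$ can replace vectors of $\mathbb
    F_q^t$. *)
Lemma weak_colouring_inj (H : hypergraph) (C D : eqType) (f : C -> D)
    (g : vertex H -> C) :
  injective f -> weak_colouring (f \o g) = weak_colouring g.
Proof.
move=> f_inj; apply: eq_forallb => e; congr negb.
apply: eq_forallb => u; congr (_ ==> _); apply: eq_forallb => w.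
by rewrite /= (inj_eq f_inj).
Qed.

(** Bridges two views of labellings: they are counted as functions into [F], while the linear
    structure is that of functions into [F^o]. *)
Lemma card_ffun_vspace (F : finFieldType) (T : finType)
    (U : {vspace {ffun T -> F^o}}) :
  #|[set a : {ffun T -> F} | (a : {ffun T -> F^o}) \in U]| = (#|F| ^ \dim U)%N.
Proof. by rewrite -(@card_vspace F {ffun T -> F}) cardsE. Qed.

(** * Monochromatic edges and labellings constant on components *)

Section ConstantOnEdges.
Variable H : hypergraph.

Definition constant_on_edge (C : eqType) (a : vertex H -> C) (e : edge H) : bool :=
  [forall u in ends e, forall w in ends e, a u == a w].

Lemma weak_colouringE (C : eqType) (a : vertex H -> C) :
  weak_colouring a = [forall e, ~~ constant_on_edge a e].
Proof. by []. Qed.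

Lemma constant_on_edgeP (C : eqType) (a : vertex H -> C) (e : edge H) :
  reflect {in ends e &, forall u w, a u = a w} (constant_on_edge a e).
Proof.
apply: (iffP 'forall_implyP) => [ca u w ue we|ca u ue].
  by have /'forall_implyP/(_ w we)/eqP := ca u ue.
by apply/'forall_implyP => w we; apply/eqP/ca.
Qed.

Lemma constant_on_edges_connect (C : eqType) (a : vertex H -> C) :
  (forall e, constant_on_edge a e) ->
  forall u w, connect (@adjacent H) u w -> a u = a w.
Proof.
move=> ca u w /connectP[p]; elim: p u => [|x p IHp] u /=; first by move=> _ ->.
case/andP=> /existsP[e /andP[ue xe]] /IHp IH /IH <-.
exact: (constant_on_edgeP _ _ (ca e)).
Qed.

(** Such a labelling amounts to a free choice of value at the root of each component. The choices
    are encoded as functions equal to the filler [c0] off the roots. *)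
Lemma card_constant_on_edges (C : finType) (c0 : C) :
  #|[set a : {ffun vertex H -> C} | [forall e, constant_on_edge a e]]|
    = (#|C| ^ kappa H)%N.
Proof.
pose r := fingraph.root (@adjacent H).
have symH := @adjacent_connect_sym H.
rewrite /kappa /n_comp_mem -(card_pffun_on c0 _ C).
(* [ext] spreads the value at each root over its whole component. *)
pose ext (f : {ffun vertex H -> C}) : {ffun vertex H -> C} := [ffun u => f (r u)].
rewrite -[RHS](card_in_imset (f := ext)).
  apply: eq_card => a; rewrite inE; apply/forallP/imsetP => [ca|[f fP ->] e].
    pose f := [ffun u => if u \in roots (@adjacent H) then a u else c0].
    exists f.
      apply/pffun_onP; split=> //.
      by apply/supportP => u; rewrite !inE andbT ffunE => ur; rewrite ifN.
    apply/ffunP => u; rewrite !ffunE -topredE /= roots_root //.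
    by apply: (constant_on_edges_connect ca); apply: connect_root.
  apply/constant_on_edgeP => u w ue we; rewrite !ffunE; congr (f _).
  apply/eqP; rewrite root_connect //; apply: connect1.
  by apply/existsP; exists e; rewrite ue.
(* Injectivity of [ext]: at a root it returns the original value, and off the roots both functions
   equal [c0]. *)
move=> f g /pffun_onP[/supportP fP _] /pffun_onP[/supportP gP _] /ffunP fg.
apply/ffunP => u; have [ur|ur] := boolP (r u == u).
  by have := fg u; rewrite !ffunE (eqP ur).
by rewrite fP ?gP // !inE andbT.
Qed.
End ConstantOnEdges.

(** * Kernel and fibres of [Phi], and dimensions of the subcodes vanishing on edge sets *)

Section PhiTheory.
Variables (F : finFieldType) (L : fieldExtType F) (H : hypergraph) (h : nat).
Variables (v : edge H -> h.+1.-tuple (vertex H)).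
Variables (iota : {linear 'rV[F]_h -> L}).
Hypotheses (v_ord : edge_ordering v) (iota_inj : injective iota).

(** Injectivity of [iota] reduces the claim to the vanishing of all differences with the first
    vertex of the edge; any two labels on the edge are then compared through that vertex. *)
Lemma Phi_eq0 (a : {ffun vertex H -> F}) (e : edge H) :
  (Phi v iota a e == 0) = constant_on_edge a e.
Proof.
have [_ ve] := v_ord e.
rewrite ffunE raddf_eq0 //; apply/eqP/constant_on_edgeP => [a0|ca].
  suff ac u : u \in ends e -> a u = a (tnth (v e) ord0) by move=> u w /ac-> /ac->.
  rewrite ve => /tnthP[j ->]; case: (unliftP ord0 j) => [k ->|-> //].
  by have /rowP/(_ k) := a0; rewrite !mxE => /eqP; rewrite subr_eq0 => /eqP.
apply/rowP => j; rewrite !mxE; apply/eqP; rewrite subr_eq0; apply/eqP.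
by apply: ca; rewrite ve mem_tnth.
Qed.

Lemma card_Phi_ker :
  #|[set a : {ffun vertex H -> F} | Phi v iota a == 0]| = (#|F| ^ kappa H)%N.
Proof.
rewrite -(card_constant_on_edges _ (0 : F)); apply: eq_card => a; rewrite !inE.
apply/eqP/forallP => [a0 e|ca]; first by rewrite -Phi_eq0 a0 ffunE.
by apply/ffunP => e; rewrite [RHS]ffunE; apply/eqP; rewrite Phi_eq0.
Qed.

(** A nonempty fibre is the translate of the kernel by any one preimage [a0]. *)
Lemma card_Phi_fibre (c : {ffun edge H -> L}) : c \in code v iota ->
  #|[set a : {ffun vertex H -> F} | Phi v iota a == c]| = (#|F| ^ kappa H)%N.
Proof.
case/codeP => a0 <-; rewrite -card_Phi_ker.
rewrite -[RHS](card_imset _ (addIr (a0 : {ffun vertex H -> F^o}))).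
apply: eq_card => a; rewrite inE; apply/eqP/imsetP => [aE|[b + ->]].
  exists (a - a0 : {ffun vertex H -> F^o}); last by rewrite subrK.
  by rewrite inE linearB /= aE subrr.
by rewrite inE linearD /= => /eqP ->; rewrite add0r.
Qed.

Lemma dim_Phi_ker : \dim (lker (linfun (Phi v iota))) = kappa H.
Proof.
have cF : (1 < #|F|)%N := finNzRing_gt1 F.
apply/eqP; rewrite -(eqn_exp2l _ _ cF) -card_Phi_ker.
rewrite -card_ffun_vspace; apply/eqP/eq_card => a.
by rewrite !inE memv_ker lfunE.
Qed.

(** The labellings counted form the preimage of the subcode [W] under [Phi], whose dimension follows
    from rank-nullity. *)
Lemma card_Phi_vanishing (A : {set edge H}) :
  #|[set a : {ffun vertex H -> F} | [forall e in A, constant_on_edge a e]]|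
    = (#|F| ^ (kappa H + \dim (vanishing (code v iota) A)))%N.
Proof.
set W := vanishing _ _; set f := linfun (Phi v iota).
have sWC : (W <= limg f)%VS by apply: capvSl.
(* Since [W] lies in the image, it is the image of its own preimage; since the kernel lies in that
   preimage, intersecting with it changes nothing. This is the shape that rank-nullity for a
   restricted map requires. *)
rewrite -(lpreimK sWC) -dim_Phi_ker.
have -> : lker f = ((f @^-1: W) :&: lker f)%VS.
  apply/esym/capv_idPr/subvP => a.
  by rewrite memv_ker -memv_preim => /eqP->; apply: mem0v.
rewrite limg_ker_dim -card_ffun_vspace.
apply: eq_card => a; rewrite !inE -memv_preim.
apply/'forall_implyP/vanishingP => [ca|[_ ca] e eA].
  split; first by apply/memv_img/memvf.
  by move=> e /ca; rewrite lfunE /= -Phi_eq0 => /eqP.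
by have := ca e eA; rewrite lfunE /= -Phi_eq0 => ->.
Qed.

End PhiTheory.

(** * Tuples of labellings as colourings by row vectors *)

Definition labelling_of_tuple (F : finFieldType) (V : finType) (t : nat)
    (a : t.-tuple {ffun V -> F}) (u : V) : 'rV[F]_t := \row_(j < t) tnth a j u.

Lemma constant_on_edge_tuple (F : finFieldType) (H : hypergraph) (t : nat)
    (a : t.-tuple {ffun vertex H -> F}) (e : edge H) :
  constant_on_edge (labelling_of_tuple a) e
    = [forall j, constant_on_edge (tnth a j) e].
Proof.
apply/constant_on_edgeP/forallP => [ca j|ca u w ue we].
  apply/constant_on_edgeP => u w ue we.
  by have /rowP/(_ j) := ca u w ue we; rewrite !mxE.
by apply/rowP => j; rewrite !mxE; apply: (constant_on_edgeP _ _ (ca j)).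
Qed.

Lemma weak_chi_card (F : finFieldType) (H : hypergraph) (t : nat) :
  weak_chi H (#|F| ^ t)
    = #|[set a : t.-tuple {ffun vertex H -> F} |
          weak_colouring (labelling_of_tuple a)]|.
Proof.
have cE : #|'rV[F]_t| = (#|F| ^ t)%N by rewrite card_mx mul1n.
(* [f] and [f'] are mutually inverse numberings of the $q^t$ row vectors. *)
pose f (x : 'rV[F]_t) : 'I_(#|F| ^ t) := cast_ord cE (enum_rank x).
pose f' (i : 'I_(#|F| ^ t)) : 'rV[F]_t := enum_val (cast_ord (esym cE) i).
have fK : cancel f f' by move=> x; rewrite /f /f' cast_ordK enum_rankK.
have f'K : cancel f' f by move=> x; rewrite /f /f' enum_valK cast_ordKV.
pose phi (a : t.-tuple {ffun vertex H -> F}) :=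
  [ffun u => f (labelling_of_tuple a u)].
have weak_phi a : weak_colouring (phi a) = weak_colouring (labelling_of_tuple a).
  rewrite -(weak_colouring_inj _ (can_inj fK)).
  apply: eq_forallb => e; congr negb.
  by do 2![apply: eq_forallb => ?; congr (_ ==> _)]; rewrite !ffunE.
have phi_inj : injective phi.
  move=> a b /ffunP ab; apply: eq_from_tnth => j; apply/ffunP => u.
  have := ab u; rewrite !ffunE => /(can_inj fK)/rowP/(_ j).
  by rewrite !mxE.
rewrite -(card_imset _ phi_inj); apply: eq_card => g; rewrite inE.
apply/idP/imsetP => [wg|[a + ->]]; last by rewrite inE weak_phi.
(* The [j]-th labelling reads off the [j]-th coordinate of the decoded colour. *)
pose a := [tuple [ffun u => f' (g u) 0 j] | j < t].
have gE : g = phi a.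
  apply/ffunP => u; rewrite ffunE; apply: (can_inj f'K); rewrite fK.
  by apply/rowP => j; rewrite mxE tnth_mktuple ffunE.
by exists a; rewrite // inE -weak_phi -gE.
Qed.

(** * Joint supports, fibres of tuples and the chromatic identity *)

Section CountingTuples.
Variables (F : finFieldType) (L : fieldExtType F) (H : hypergraph) (h t : nat).
Variables (v : edge H -> h.+1.-tuple (vertex H)).
Variables (iota : {linear 'rV[F]_h -> L}).
Hypotheses (v_ord : edge_ordering v) (iota_inj : injective iota).

Lemma weak_colouring_support (a : t.-tuple {ffun vertex H -> F}) :
  weak_colouring (labelling_of_tuple a) <->
  (\bigcup_(j < t) codeword_support (tnth (Phi_tuple v iota a) j))%SET
    = [set: edge H].
Proof.
rewrite weak_colouringE; split=> [/forallP wa|supT].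
  apply/setP => e; rewrite inE; apply/bigcupP.
  have := wa e; rewrite constant_on_edge_tuple => /forallPn[j aj]; exists j => //.
  by rewrite inE tnth_mktuple Phi_eq0.
apply/forallP => e; rewrite constant_on_edge_tuple; apply/forallPn.
have : e \in [set: edge H] by [].
rewrite -supT => /bigcupP[j _]; rewrite inE tnth_mktuple Phi_eq0 //.
by exists j.
Qed.

(** The fibre is a product of [t] fibres of [Phi], one for each codeword. *)
Lemma card_Phi_tuple_fibre (c : t.-tuple {ffun edge H -> L}) :
  (forall j : 'I_t, tnth c j \in code v iota) ->
  #|[set a : t.-tuple {ffun vertex H -> F} | Phi_tuple v iota a == c]|
    = (#|F| ^ (t * kappa H))%N.
Proof.
move=> cC.
pose P j : pred {ffun vertex H -> F} := fun a => Phi v iota a == tnth c j.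
transitivity
  #|[set a : t.-tuple {ffun vertex H -> F} | [forall j, P j (tnth a j)]]|.
  apply: eq_card => a; rewrite !inE; apply/eqP/forallP => [ac j|ac].
    by rewrite /P -ac tnth_mktuple.
  by apply: eq_from_tnth => j; rewrite tnth_mktuple; apply/eqP/ac.
rewrite card_tuple_family (eq_bigr (fun=> #|F| ^ kappa H)%N) => [|j _].
  by rewrite prod_nat_const card_ord -expnM mulnC.
by rewrite -(card_Phi_fibre v_ord iota_inj (cC j)) cardsE.
Qed.

(** Constancy on an edge is tested coordinate by coordinate, so the count is the [t]-th power of the
    count for a single labelling. *)
Lemma card_tuple_constant_on (A : {set edge H}) :
  #|[set a : t.-tuple {ffun vertex H -> F} |
      [forall e in A, constant_on_edge (labelling_of_tuple a) e]]|
    = (#|F| ^ (t * kappa H) * (#|F| ^ t) ^ \dim (vanishing (code v iota) A))%N.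
Proof.
pose P : pred {ffun vertex H -> F} :=
  fun a => [forall e in A, constant_on_edge a e].
transitivity
  #|[set a : t.-tuple {ffun vertex H -> F} | [forall j, P (tnth a j)]]|.
  apply: eq_card => a; rewrite !inE.
  apply/'forall_implyP/forallP => [ca j|ca e eA].
    by apply/'forall_implyP => e /ca; rewrite constant_on_edge_tuple => /forallP/(_ j).
  rewrite constant_on_edge_tuple; apply/forallP => j.
  by have /'forall_implyP/(_ e eA) := ca j.
rewrite (card_tuple_family (fun=> P)) prod_nat_const card_ord.
have -> : #|P| = (#|F| ^ (kappa H + \dim (vanishing (code v iota) A)))%N.
  by rewrite -card_Phi_vanishing // cardsE.
by rewrite -!expnM -expnD mulnC mulnDr.
Qed.

Lemma weak_chi_char_poly :
  (weak_chi H (#|F| ^ t))%:Z =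
    (#|F| ^ (t * kappa H))%:Z *
      (char_poly_code (code v iota)).[(#|F| ^ t)%:Z].
Proof.
(* [Z a] is the set of monochromatic edges, empty exactly for weak colourings. *)
pose Z (a : t.-tuple {ffun vertex H -> F}) :=
  [set e | constant_on_edge (labelling_of_tuple a) e].
have weakE a : weak_colouring (labelling_of_tuple a) = (Z a == set0).
  rewrite weak_colouringE; apply/forallP/eqP => [wa|Za e].
    by apply/setP => e; rewrite !inE; apply: negPf (wa e).
  by have /setP/(_ e) := Za; rewrite !inE => /negbT.
have subZ (A : {set edge H}) a : (A \subset Z a) =
    [forall e in A, constant_on_edge (labelling_of_tuple a) e].
  by apply/subsetP/'forall_implyP => ZA e /ZA; rewrite inE.
rewrite weak_chi_card -sum1_card -[LHS]natz natr_sum big_mkcond /=.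
(* The indicator of [Z a] being empty is replaced by the signed sum over the subsets of [Z a]. *)
transitivity (\sum_a \sum_(A : {set edge H} | A \subset Z a) (-1) ^+ #|A| : int).
  by apply: eq_bigr => a _; rewrite sum_sign_subset inE weakE; case: eqP.
(* After the exchange, the inner sum for a fixed [A] counts the tuples monochromatic on every edge
   of [A], which gives the term of the characteristic polynomial at [A] times $q^{t\kappa(H)}$. *)
rewrite (exchange_big_dep xpredT) //= horner_sum mulr_sumr.
apply: eq_bigr => A _; rewrite hornerZ hornerXn mulrCA (eq_bigl _ _ (subZ A)).
rewrite sumr_const -[LHS]mulr_natr; congr (_ * _).
by rewrite -!natz -natrX -natrM -card_tuple_constant_on cardsE.
Qed.

End CountingTuples.

Theorem proposition4p15 (q r h t : nat) (F : finFieldType) (L : fieldExtType F)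
    (H : hypergraph) (v : edge H -> h.+1.-tuple (vertex H))
    (iota : {linear 'rV[F]_h -> L})
    (cardF : #|F| = q) (r_ge2 : (2 <= r)%N) (hE : h = (r - 1)%N)
    (t_ge1 : (1 <= t)%N) (dimL : \dim {:L} = h)
    (H_unif : uniform r H) (v_ord : edge_ordering v)
    (iota_bij : bijective iota) :
  [/\ (forall a : t.-tuple {ffun vertex H -> F},
        weak_colouring (fun u : vertex H => \row_(j < t) tnth a j u) <->
        (\bigcup_(j < t) codeword_support (tnth (Phi_tuple v iota a) j))%SET
          = [set: edge H]),
      (forall c : t.-tuple {ffun edge H -> L},
        (forall j : 'I_t, tnth c j \in code v iota) ->
        #|[set a : t.-tuple {ffun vertex H -> F} | Phi_tuple v iota a == c]|
          = (q ^ (t * kappa H))%N)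
    & (weak_chi H (q ^ t))%:Z =
        (q ^ (t * kappa H))%:Z * (char_poly_code (code v iota)).[(q ^ t)%:Z]].
Proof.
have iota_inj := bij_inj iota_bij; rewrite -cardF; split=> [a|c cC|].
- exact: weak_colouring_support.
- exact: card_Phi_tuple_fibre.
- exact: weak_chi_char_poly.
Qed.
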